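(* Let $n_1,n_2,n_3$ be positive integers. Let $\mathcal{Z}^{\mathrm{Cyl}}_{4n_1,2n_2,2n_3}$ be the partition function of the monopole-dimer model on the three-dimensional cylindrical grid $Q^{\mathrm{Cyl}}_{4n_1,2n_2,2n_3}$ and $\mathcal{Z}^{\mathrm{M\ddot{o}b}}_{2n_1,2n_2,2n_3}$ that on the three-dimensional Möbius grid $Q^{\mathrm{M\ddot{o}b}}_{2n_1,2n_2,2n_3}$, both with boustrophedon labelling, the orientations and weights described below. Then $$\mathcal{Z}^{\mathrm{Cyl}}_{4n_1,2n_2,2n_3}=\big(\mathcal{Z}^{\mathrm{M\ddot{o}b}}_{2n_1,2n_2,2n_3}\big)^2.$$
   Context: Boustrophedon labelling of $[2N_1]\times[2N_2]\times[2N_3]$: vertex $(p,q,r)$ gets label $8tN_1N_2+4sN_1+p$ if $q=2s+1,r=2t+1$; $8tN_1N_2+4sN_1-p+1$ if $q=2s,r=2t+1$; $8tN_1N_2-4sN_1-p+1$ if $q=2s+1,r=2t$; $8tN_1N_2-4sN_1+p$ if $q=2s,r=2t$. The grid $Q_{n_1,n_2,n_3}$ has vertex set $[n_1]\times[n_2]\times[n_3]$, two vertices adjacent iff they differ by $1$ in exactly one coordinate. The cylindrical grid $Q^{\mathrm{Cyl}}_{n_1,n_2,n_3}=C_{n_1}\square P_{n_2}\square P_{n_3}$ additionally has edges between $(1,k_2,k_3)$ and $(n_1,k_2,k_3)$; all its edges are directed from lower to higher label. The Möbius grid $Q^{\mathrm{M\ddot{o}b}}_{n_1,n_2,n_3}$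 is $Q_{n_1,n_2,n_3}$ (''solid edges'') plus ''dashed edges'' between $(1,k_2,k_3)$ and $(n_1,n_2-k_2+1,n_3-k_3+1)$ for all $k_2,k_3$; solid edges are directed from lower to higher label, the dashed edge at the vertex labelled $1$ is directed away from it, and the other dashed edges are directed so that every two-dimensional square (4-cycle formed by two dashed edges and the solid edges joining their endpoints) has an odd number of edges directed along each of its traversal directions. In both graphs all vertices have weight $x$ and edges along the first, second, third coordinate direction (wrap-around and dashed edges counting as first direction) have weights $a_1,a_2,a_3$. The monopole-dimer (loop-vertex) model on an oriented weighted graph: $\mathrm{sgn}(v,v')=\pm1$ according as $v\to v'$ or $v'\to v$; configurations are collections of vertex-disjoint directed even cycles of length $\ge4$ (both directions distinct), doubled edges and isolated vertices covering every vertex exactly once; a loop $(v_0,\dots,v_{2k}=v_0)$ has weight $-\prod_i\mathrm{sgn}(v_i,v_{i+1})a_{v_i,v_{i+1}}$ (doubled edge: $a_{u,v}^2$), a configuration has weight the product of loop weights and $x$ per isolated vertex, and the partition function is the sum over configurations. *)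

(* Defs.v *)
From HB Require Import structures.
From mathcomp Require Import all_boot all_order all_algebra all_fingroup.

Set Implicit Arguments.
Unset Strict Implicit.
Unset Printing Implicit Defensive.

Import GRing.Theory.
Local Open Scope ring_scope.

(* [edge] is the underlying simple graph, [arc u v] says that the edge
   {u, v} is directed from u to v. *)
Record owgraph (R : comNzRingType) := OWGraph {
  vertex : finType;
  edge : rel vertex;
  arc : rel vertex;
  vweight : vertex -> R;
  eweight : vertex -> vertex -> R
}.

Section MonopoleDimer.

Variables (R : comNzRingType) (G : owgraph R).
Implicit Types (u v : vertex G) (s : {perm vertex G}) (O : {set vertex G}).

(* Only meaningful when {u, v} is an edge. *)
Definition sgn u v : R := if arc u v then 1 else -1.

(* A configuration is encoded by its successor permutation s: fixed points are
   isolated vertices, 2-cycles are doubled edges, longer cycles are directed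
   loops (the two directions of a loop give two different permutations). *)
Definition configuration s : bool :=
  [forall v, (s v != v) ==> edge v (s v)] &&
  [forall v, (#|porbit s v| == 1%N) || ~~ odd #|porbit s v|].

(* For a doubled edge O = {u, v} the product below is a_{u,v} a_{v,u}. *)
Definition loop_weight s O : R :=
  if #|O| == 1%N then \prod_(v in O) vweight v
  else if #|O| == 2%N then \prod_(v in O) eweight v (s v)
  else - \prod_(v in O) (sgn v (s v) * eweight v (s v)).

Definition config_weight s : R := \prod_(O in porbits s) loop_weight s O.

Definition partition_function : R :=
  \sum_(s : {perm vertex G} | configuration s) config_weight s.

End MonopoleDimer.

Section Grids.

Variables m1 m2 m3 : nat.

Definition box : finType := ('I_m1 * 'I_m2 * 'I_m3)%type.

Implicit Types u v w z : box.

(* Coordinates are 1-based. *)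
Definition crd1 v : nat := v.1.1.+1.
Definition crd2 v : nat := v.1.2.+1.
Definition crd3 v : nat := v.2.+1.

(* Used for even m1 = 2 N1 and m2 = 2 N2; on the box no subtraction below is
   truncated, when read from left to right. *)
Definition boustrophedon v : nat :=
  let N1 := m1./2 in let N2 := m2./2 in
  let p := crd1 v in let q := crd2 v in let r := crd3 v in
  let s := q./2 in let t := r./2 in
  (if odd r then
     if odd q then 8 * t * N1 * N2 + 4 * s * N1 + p
     else 8 * t * N1 * N2 + 4 * s * N1 - p + 1
   else
     if odd q then 8 * t * N1 * N2 - 4 * s * N1 - p + 1
     else 8 * t * N1 * N2 - 4 * s * N1 + p)%N.

Definition differ_by1 (i j : nat) : bool := (i.+1 == j) || (j.+1 == i).

Definition step1 u v : bool :=
  [&& differ_by1 (crd1 u) (crd1 v), crd2 u == crd2 v & crd3 u == crd3 v].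
Definition step2 u v : bool :=
  [&& crd1 u == crd1 v, differ_by1 (crd2 u) (crd2 v) & crd3 u == crd3 v].
Definition step3 u v : bool :=
  [&& crd1 u == crd1 v, crd2 u == crd2 v & differ_by1 (crd3 u) (crd3 v)].

Definition grid_edge u v : bool := [|| step1 u v, step2 u v | step3 u v].

Definition wrap_edge u v : bool :=
  [&& (crd1 u == 1%N) && (crd1 v == m1) || (crd1 v == 1%N) && (crd1 u == m1),
      crd2 u == crd2 v & crd3 u == crd3 v].

Definition dashed_from u v : bool :=
  [&& crd1 u == 1%N, crd1 v == m1,
      crd2 v == (m2 - crd2 u + 1)%N & crd3 v == (m3 - crd3 u + 1)%N].
Definition dashed_edge u v : bool := dashed_from u v || dashed_from v u.

Definition cyl_edge u v : bool := grid_edge u v || wrap_edge u v.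
Definition mob_edge u v : bool := grid_edge u v || dashed_edge u v.

Definition label_arc (e : rel box) : rel box :=
  fun u v => e u v && (boustrophedon u < boustrophedon v)%N.

Definition orientation_of (e o : rel box) : Prop :=
  (forall u v, o u v -> e u v) /\
  (forall u v, e u v -> o u v = ~~ o v u).

(* The square condition ranges over all ways to traverse a square starting with
   a dashed edge, hence over both traversal directions. *)
Definition mobius_orientation (o : rel box) : Prop :=
  [/\ orientation_of mob_edge o,
      forall u v, grid_edge u v -> o u v = (boustrophedon u < boustrophedon v)%N,
      forall u v, boustrophedon u = 1%N -> dashed_edge u v -> o u v
    & forall u v w z, uniq [:: u; v; w; z] ->
        dashed_edge u v -> grid_edge v w -> dashed_edge w z -> grid_edge z u ->
        odd (o u v + o v w + o w z + o z u)%N].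

Variables (R : comNzRingType) (x a1 a2 a3 : R).

(* Wrap-around and dashed edges count as edges in the first direction. *)
Definition grid_weight (extra : rel box) u v : R :=
  if step1 u v || extra u v then a1
  else if step2 u v then a2
  else if step3 u v then a3
  else 0.

Definition cyl_grid : owgraph R :=
  OWGraph cyl_edge (label_arc cyl_edge) (fun=> x) (grid_weight wrap_edge).

Definition mob_grid (o : rel box) : owgraph R :=
  OWGraph mob_edge o (fun=> x) (grid_weight dashed_edge).

End Grids.

Definition Zcyl (R : comNzRingType) (m1 m2 m3 : nat) (x a1 a2 a3 : R) : R :=
  partition_function (cyl_grid m1 m2 m3 x a1 a2 a3).

Definition Zmob (R : comNzRingType) (m1 m2 m3 : nat) (o : rel (box m1 m2 m3))
    (x a1 a2 a3 : R) : R :=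
  partition_function (mob_grid x a1 a2 a3 o).

(* Main.v *)
(** Every configuration is a permutation, both graphs are bipartite and their
    arcs are antisymmetric, so the partition function is the determinant of
    the signed weighted adjacency matrix.

    With the index shifted to start at 0 and m = 2 n1, the boustrophedon sign
    of a step in the first, second, third direction is (-1)^(q+r), (-1)^r, 1
    times the direction of the step, and the square condition forces the dashed
    edge leaving (0, q, r) to have sign (-1)^q.  Cutting the cylinder of length
    2m into halves gives the block matrix [[A, B], [-B, A]].  The signed
    permutation W : (p, q, r) |-> (p, rev q, rev r) with sign (-1)^r commutes
    with A and B and satisfies W^2 = -1, so W plays the role of the imaginary
    unit: the determinant is det (A + B W) * det (A - B W), and A + B W is the
    Moebius matrix.  The signed permutation (p, q, r) |-> (rev p, q, r) with
    sign (-1)^p commutes with A and anticommutes with B W, so both factors are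
    equal. *)

Require Import Defs.
From mathcomp Require Import all_boot all_order all_algebra all_fingroup.
From mathcomp Require Import zify ring.
Set Implicit Arguments.
Unset Strict Implicit.
Unset Printing Implicit Defensive.
Import GRing.Theory.
Local Open Scope ring_scope.

(** * Determinants over an arbitrary finite index type *)

Lemma odd_perm_conj (T T' : finType) (f : T -> T') (s : {perm T})
    (s' : {perm T'}) :
  bijective f -> (forall v, s' (f v) = f (s v)) -> s' = s :> bool.
Proof.
move=> fbij s'f; have finj := bij_inj fbij; have [g fK gK] := fbij.
have [ts sE dts] := prod_tpermP s.
pose ts' := [seq (f t.1, f t.2) | t <- ts].
(* Parity is read off a factorisation into transpositions, and a bijection carries transpositions to
   transpositions. *)
have s'E : s' = (\prod_(t <- ts') tperm t.1 t.2)%g.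
  apply/permP => w; rewrite -{}[w]gK; move: (g w) => {w} v.
  rewrite s'f sE /ts' {sE dts ts'}.
  elim: ts v => [|[a b] ts IH] v /=; first by rewrite !big_nil !perm1.
  by rewrite !big_cons /= !permM -inj_tperm // IH.
rewrite s'E sE !odd_perm_prod ?size_map //.
rewrite all_map; apply: sub_all dts => -[a b] /=.
by rewrite /dpair /= (inj_eq finj).
Qed.

Section FiniteDeterminant.

Variable R : comNzRingType.

(** The Leibniz formula, with vertices themselves as row and column indices, so that no enumeration
    of them enters the combinatorial part. *)
Definition fdet (T : finType) (M : T -> T -> R) : R :=
  \sum_(s : {perm T}) (-1) ^+ s * \prod_v M v (s v).

Lemma fdet_bij (T T' : finType) (f : T -> T') (M : T' -> T' -> R) :
  bijective f -> fdet M = fdet (fun u v => M (f u) (f v)).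
Proof.
move=> fbij; have [g fK gK] := fbij.
have finj := bij_inj fbij; have ginj := can_inj gK.
have conj_inj (s : {perm T}) : injective (f \o s \o g).
  by apply: inj_comp ginj; apply: inj_comp finj perm_inj.
have conj_inj' (s : {perm T'}) : injective (g \o s \o f).
  by apply: inj_comp finj; apply: inj_comp ginj perm_inj.
pose h s := perm (conj_inj s); pose h' s := perm (conj_inj' s).
have hf s v : h s (f v) = f (s v) by rewrite permE /= fK.
rewrite /fdet (reindex h) /=; last first.
  by exists h' => s _; apply/permP => v; rewrite !permE /= !permE /= ?fK ?gK.
apply: eq_bigr => s _; rewrite (odd_perm_conj fbij (hf s)); congr (_ * _).
rewrite (reindex f) /=; last exact: onW_bij.
by apply: eq_bigr => v _; rewrite hf.
Qed.

Lemma fdet_mx n (T : finType) (f : 'I_n -> T) (M : T -> T -> R) :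
  bijective f -> fdet M = \det (\matrix_(i, j) M (f i) (f j)).
Proof.
move=> fbij; rewrite (fdet_bij _ fbij) /determinant /fdet.
by apply: eq_bigr => s _; congr (_ * _); apply: eq_bigr => i _; rewrite mxE.
Qed.

End FiniteDeterminant.

(** * The partition function as a determinant *)

Lemma partition_porbits (T : finType) (s : {perm T}) :
  partition (porbits s) [set: T].
Proof.
have eqr : {in [set: T] & &, equivalence_rel (fun u v => v \in porbit s u)}.
  move=> u v w _ _ _; split; first exact: porbit_id.
  by rewrite -eq_porbit_mem => /eqP->.
suff -> : porbits s = equivalence_partition (fun u v => v \in porbit s u) setT.
  exact: equivalence_partitionP eqr.
apply/setP => O; apply/imsetP/imsetP => -[v _ ->]; exists v => //.
  by apply/setP => w; rewrite !inE.
by apply/setP => w; rewrite !inE.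
Qed.

(** A permutation has the parity of the number of points plus the number of cycles; the cycle
    lengths sum to the number of points, so each cycle can be charged its length plus one. *)
Lemma sign_porbits (R : comNzRingType) (T : finType) (s : {perm T}) :
  (-1) ^+ s = \prod_(O in porbits s) (-1) ^+ #|O|.+1 :> R.
Proof.
rewrite prodrXr /odd_perm signr_addb !signr_odd -exprD.
congr (_ ^+ _); under [RHS]eq_bigr => O _ do rewrite -addn1.
by rewrite big_split /= sum1_card -(card_partition (partition_porbits s)) cardsT.
Qed.

Section SignedAdjacency.

Variables (R : comNzRingType) (G : owgraph R).

Definition signed_adjacency (u v : vertex G) : R :=
  if u == v then vweight u
  else if edge u v then sgn u v * eweight u v else 0.

Variable col : vertex G -> bool.
Hypothesis edge_col : forall u v : vertex G, edge u v -> col v = ~~ col u.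
Hypothesis arc_anti : forall u v : vertex G, edge u v -> Defs.arc u v = ~~ Defs.arc v u.

(** Every step along a nontrivial orbit changes the colour, and going once around restores it. *)
Lemma bipartite_even_orbit (s : {perm vertex G}) v :
  (forall u, (s u != u) ==> edge u (s u)) -> #|porbit s v| != 1%N ->
  ~~ odd #|porbit s v|.
Proof.
move=> sedge nfix.
(* A fixed iterate would make the orbit a singleton. *)
have moved k : iter k s v != s (iter k s v).
  apply: contra nfix => /eqP fixk.
  have : #|porbit s (iter k s v)| = 1%N.
    apply/eqP/cards1P; exists (iter k s v); apply/setP => w; rewrite inE.
    apply/porbitP/eqP => [[i ->]|->]; last by exists 0; rewrite expg0 perm1.
    by rewrite permX; elim: i => //= i ->; rewrite -fixk.
  by rewrite -permX porbit_perm => ->.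
have colk k : col (iter k s v) = odd k (+) col v.
  elim: k => //= k IH.
  have /implyP/(_ _)/edge_col-> := sedge (iter k s v); last by rewrite eq_sym.
  by rewrite IH addNb.
have := colk #|porbit s v|; rewrite iter_porbit.
by case: (odd _) => //; case: (col v).
Qed.

(** An isolated vertex gets sign +1. An even orbit gets sign -1, which is the minus sign of a long
    loop; for a doubled edge the two opposite values of [sgn] multiply to -1 and cancel it. *)
Lemma loop_weight_orbit (s : {perm vertex G}) O :
  configuration s -> O \in porbits s ->
  loop_weight s O = (-1) ^+ #|O|.+1 * \prod_(v in O) signed_adjacency v (s v).
Proof.
move=> /andP[/forallP sedge /forallP seven] /imsetP[v _ OE].
have moved u : u \in O -> #|O| != 1%N -> s u != u.
  rewrite OE -eq_porbit_mem eq_sym => /eqP vu; apply: contra => /eqP fixu.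
  rewrite vu; apply/cards1P; exists u; apply/setP => w; rewrite inE.
  apply/porbitP/eqP => [[i ->]|->]; last by exists 0; rewrite expg0 perm1.
  by rewrite permX; elim: i => //= i ->.
have adjE u : u \in O -> #|O| != 1%N ->
    signed_adjacency u (s u) = sgn u (s u) * eweight u (s u).
  move=> uO nO; rewrite /signed_adjacency eq_sym (negPf (moved u uO nO)).
  by rewrite (implyP (sedge u) (moved u uO nO)).
rewrite /loop_weight; case: eqVneq => [O1|nO1].
  rewrite O1 expr2 mulrNN !mul1r; apply: eq_bigr => u uO.
  have /cards1P[w Ow] : #|O| == 1%N by rewrite O1.
  have suO : s u \in O.
    by move: uO; rewrite OE -!eq_porbit_mem => /eqP<-; rewrite -[s]expg1 porbit_perm.
  move: uO suO; rewrite Ow !inE => /eqP-> /eqP->.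
  by rewrite /signed_adjacency eqxx.
rewrite [in RHS](eq_bigr _ (fun u uO => adjE u uO nO1)).
have evO : ~~ odd #|O| by have := seven v; rewrite -OE (negPf nO1).
rewrite exprS -signr_odd (negPf evO) expr0 mulr1 mulN1r.
case: eqVneq => // O2; rewrite big_split /=.
suff -> : \prod_(u in O) sgn u (s u) = -1 :> R by rewrite mulN1r opprK.
have vO : v \in O by rewrite OE porbit_id.
have svO : s v \in O by rewrite OE -[s v]/(iter 1 s v) -permX mem_porbit.
have nsv := moved v vO nO1.
have ssv : s (s v) = v.
  by have := iter_porbit s v; rewrite -OE O2.
have -> : O = [set v; s v].
  apply/esym/eqP; rewrite eqEcard cards2 eq_sym nsv O2 andbT.
  by rewrite subUset !sub1set vO.
rewrite big_setU1 ?inE ?big_set1 1?eq_sym //= ssv.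
have ev := implyP (sedge v) nsv.
by rewrite /sgn (arc_anti ev); case: (Defs.arc _ _); rewrite /= ?mulN1r ?mul1r.
Qed.

Lemma partition_function_fdet : partition_function G = fdet signed_adjacency.
Proof.
rewrite /fdet [RHS](bigID (@configuration R G)) /= [X in _ + X]big1 ?addr0.
  apply: eq_bigr => s sconf; rewrite /config_weight sign_porbits.
  rewrite [X in _ * X](eq_bigl (mem [set: vertex G]));
    last by move=> v /=; rewrite in_setT.
  rewrite (set_partition_big _ (partition_porbits s)) -big_split /=.
  by apply: eq_bigr => O; apply: loop_weight_orbit.
(* A permutation that is not a configuration must use a non-edge, and so has a zero factor: the
   parity condition alone cannot fail, by bipartiteness. *)
move=> s; rewrite /configuration negb_and => ns.
have [/forallP sedge|/forallPn[v]] :=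
    boolP [forall v, (s v != v) ==> edge v (s v)].
  case/orP: ns => [/forallPn[v]|/forallPn[v]]; first by rewrite sedge.
  rewrite negb_or => /andP[n1 /negP[]]; exact: bipartite_even_orbit.
rewrite negb_imply => /andP[nsv nev].
by rewrite (bigD1 v) //= /signed_adjacency eq_sym (negPf nsv) (negPf nev) mul0r mulr0.
Qed.

End SignedAdjacency.

(** * Determinant of a double cover with signed permutation symmetries *)

Section DoubleCover.

Variable R : comNzRingType.

(** [P (-1)] is inverse to [P 1], and conjugating by them makes the matrix block triangular: the
    lower left block becomes [- B - B *m W *m W], which vanishes. *)
Lemma det_block_rotation n (A B W : 'M[R]_n) :
  W *m A = A *m W -> W *m B = B *m W -> W *m W = - 1%:M ->
  \det (block_mx A B (- B) A) = \det (A + B *m W) * \det (A - B *m W).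
Proof.
move=> WA WB WW.
pose P c : 'M[R]_(n + n) := block_mx 1%:M 0 (c *: W) 1%:M.
have detP c : \det (P c) = 1 by rewrite det_lblock !det1 mulr1.
have : P (-1) *m block_mx A B (- B) A *m P 1 =
    block_mx (A + B *m W) B 0 (A - B *m W).
  rewrite !mulmx_block !scaleN1r !scale1r !mul1mx !mul0mx !mulmx1 !mulmx0.
  rewrite !addr0 add0r !mulNmx mulmxDl !mulNmx WA WB -!mulmxA WW.
  congr block_mx; last by rewrite add0r addrC.
  by rewrite mulmxN mulmx1 opprK [B + _]addrC -opprD addNr.
move/(congr1 determinant); rewrite !det_mulmx !detP mul1r mulr1 => ->.
exact: det_ublock.
Qed.

(** Moving [U] through the sum turns [U *m (A + D) *m U] into [- (A - D)], while [U] contributes to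
    the determinant only through [U *m U]. *)
Lemma det_opp_twist n (A D U : 'M[R]_n) :
  U *m A = A *m U -> U *m D = - (D *m U) -> U *m U = - 1%:M ->
  \det (A - D) = \det (A + D).
Proof.
move=> UA UD UU.
have : U *m (A + D) *m U = (A - D) *m (U *m U).
  by rewrite mulmxDr UA UD -mulNmx -mulmxDl mulmxA.
move/(congr1 determinant); rewrite !det_mulmx mulrAC -det_mulmx UU.
rewrite -scaleN1r detZ det1 mulr1 [RHS]mulrC.
(* The common factor [(-1) ^+ n] is removed by multiplying with it once more; no division in the
   ring is required. *)
by move/(congr1 ( *%R ((-1) ^+ n))); rewrite !mulrA -expr2 sqrr_sign !mul1r.
Qed.

Definition fun_mx (T : finType) (M : T -> T -> R) : 'M[R]_#|T| :=
  \matrix_(i, j) M (enum_val i) (enum_val j).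

(** A signed permutation matrix when [f] is a bijection and [c] takes the values 1 and -1: row [u]
    has its only possible nonzero entry in column [f u]. *)
Definition monomial (T : finType) (f : T -> T) (c : T -> R) (u v : T) : R :=
  if v == f u then c u else 0.

Section Monomial.

Variables (T : finType) (f : T -> T) (c : T -> R).
Implicit Type M : T -> T -> R.
Hypothesis ff : involutive f.

Lemma mulmx_monomial_l M :
  fun_mx (monomial f c) *m fun_mx M = fun_mx (fun u v => c u * M (f u) v).
Proof.
apply/matrixP => i j; rewrite !mxE.
under eq_bigr => k _ do rewrite !mxE /monomial.
rewrite (bigD1 (enum_rank (f (enum_val i)))) //= enum_rankK eqxx.
rewrite big1 ?addr0 // => k /eqP nk; case: eqP => [e|]; last by rewrite mul0r.
by case: nk; rewrite -e enum_valK.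
Qed.

Lemma mulmx_monomial_r M :
  fun_mx M *m fun_mx (monomial f c) = fun_mx (fun u v => M u (f v) * c (f v)).
Proof.
apply/matrixP => i j; rewrite !mxE.
under eq_bigr => k _ do rewrite !mxE /monomial.
rewrite (bigD1 (enum_rank (f (enum_val j)))) //= enum_rankK ff eqxx.
rewrite big1 ?addr0 // => k /eqP nk; case: eqP => [e|]; last by rewrite mulr0.
by case: nk; rewrite e ff enum_valK.
Qed.

(** The hypothesis at the pair [u], [f v] is the equality of the entries of the two products;
    applying [f] on both sides displays it as a symmetry of [M]. *)
Lemma monomial_commutes M :
  (forall u v, c u * M (f u) (f v) = M u v * c v) ->
  fun_mx (monomial f c) *m fun_mx M = fun_mx M *m fun_mx (monomial f c).
Proof.
move=> cM; rewrite mulmx_monomial_l mulmx_monomial_r.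
by apply/matrixP => i j; rewrite !mxE -cM ff.
Qed.

Lemma monomial_anticommutes M :
  (forall u v, c u * M (f u) (f v) = - (M u v * c v)) ->
  fun_mx (monomial f c) *m fun_mx M = - (fun_mx M *m fun_mx (monomial f c)).
Proof.
move=> cM; rewrite mulmx_monomial_l mulmx_monomial_r.
by apply/matrixP => i j; rewrite !mxE -cM ff.
Qed.

Lemma monomial_square_opp :
  (forall u, c u * c (f u) = -1) ->
  fun_mx (monomial f c) *m fun_mx (monomial f c) = - 1%:M.
Proof.
move=> cc; rewrite mulmx_monomial_r; apply/matrixP => i j.
rewrite !mxE /monomial (can_eq ff) (inj_eq enum_val_inj) eq_sym.
by case: eqP => [->|_]; rewrite ?mul0r ?oppr0 // cc.
Qed.

End Monomial.

(** Here [f] and [c] give the square root [W] of -1 that splits the block matrix, [D] is [B] times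
    [W], and [g] and [e] give the twist that identifies the two factors. *)
Lemma fdet_double_cover (T T' : finType) (inc : T + T -> T')
    (M : T' -> T' -> R) (A B : T -> T -> R)
    (f g : T -> T) (c e : T -> R) :
  bijective inc ->
  (forall u v, M (inc (inl u)) (inc (inl v)) = A u v) ->
  (forall u v, M (inc (inl u)) (inc (inr v)) = B u v) ->
  (forall u v, M (inc (inr u)) (inc (inl v)) = - B u v) ->
  (forall u v, M (inc (inr u)) (inc (inr v)) = A u v) ->
  involutive f -> (forall u, c u * c (f u) = -1) ->
  involutive g -> (forall u, e u * e (g u) = -1) ->
  (forall u v, c u * A (f u) (f v) = A u v * c v) ->
  (forall u v, c u * B (f u) (f v) = B u v * c v) ->
  (forall u v, e u * A (g u) (g v) = A u v * e v) ->
  let D := fun u v => B u (f v) * c (f v) in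
  (forall u v, e u * D (g u) (g v) = - (D u v * e v)) ->
  fdet M = fdet (fun u v => A u v + D u v) ^+ 2.
Proof.
move=> incbij M11 M12 M21 M22 ff cc gg ee cA cB eA D eD.
pose h (i : 'I_(#|T| + #|T|)) : T' :=
  inc (match split i with inl j => inl (enum_val j)
                        | inr j => inr (enum_val j) end).
have hbij : bijective h.
  have [k incK kK] := incbij.
  exists (fun w => unsplit (match k w with inl u => inl (enum_rank u)
                                         | inr u => inr (enum_rank u) end)).
    move=> i; rewrite /h incK -[RHS]splitK.
    by case: (split i) => j; rewrite enum_valK.
  move=> w; rewrite /h unsplitK -[RHS]kK.
  by case: (k w) => u; rewrite enum_rankK.
rewrite (fdet_mx M hbij) (fdet_mx _ (enum_val_bij T)).
have -> : \matrix_(i, j) M (h i) (h j) =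
    block_mx (fun_mx A) (fun_mx B) (- fun_mx B) (fun_mx A).
  apply/matrixP => i j; rewrite !mxE /h.
  by case: (split i) => i'; rewrite mxE; case: (split j) => j'; rewrite !mxE.
have -> : \matrix_(i, j) (A (enum_val i) (enum_val j) + D (enum_val i) (enum_val j)) =
    fun_mx A + fun_mx D.
  by apply/matrixP => i j; rewrite !mxE.
rewrite (det_block_rotation (W := fun_mx (monomial f c)));
  try exact: monomial_commutes; last exact: monomial_square_opp.
rewrite mulmx_monomial_r // -/D expr2; congr (_ * _).
apply: (det_opp_twist (U := fun_mx (monomial g e))).
- exact: monomial_commutes.
- exact: monomial_anticommutes.
- exact: monomial_square_opp.
Qed.

End DoubleCover.

(** * The order of the boustrophedon labels *)

Section Labels.

Local Open Scope nat_scope.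

Variables n1 n2 m3 : nat.
Implicit Types u v : box (2 * n1) (2 * n2) m3.

Definition snake (flip : bool) (m i : nat) : nat := if flip then m.-1 - i else i.

(** In 0-based coordinates the label is a mixed radix expansion with digits r, q, p from the most
    significant down, where q is read backwards in odd layers and p is read backwards when q + r is
    odd. *)
Lemma boustrophedonE u :
  boustrophedon u =
  ((u.2 * (2 * n2) + snake (odd u.2) (2 * n2) u.1.2) * (2 * n1) +
   snake (odd (u.1.2 + u.2)) (2 * n1) u.1.1).+1.
Proof.
case: u => [[[p hp] [q hq]] [r hr]]; rewrite /boustrophedon /crd1 /crd2 /crd3 /=.
rewrite !mul2n !doubleK -!mul2n.
have [s qE] : exists s, q = odd q + s.*2 by exists q./2; rewrite odd_double_half.
have [t rE] : exists t, r = odd r + t.*2 by exists r./2; rewrite odd_double_half.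
rewrite /snake oddD !uphalf_half.
have -> : q./2 = s by lia.
have -> : r./2 = t by lia.
have hs : s < n2 by lia.
(* Nonlinear bounds handed to [nia], which has to show that the natural subtractions in the label do
   not truncate. *)
have hsn : s.+1 * n1 <= n2 * n1 by rewrite leq_mul2r hs orbT.
have hn : n1 <= n1 * n2 by lia.
have htn : t * n1 * n2 >= 0 by [].
move: qE rE; case: (odd q); case: (odd r) => /= -> ->; rewrite ?oddD ?odd_double /=; nia.
Qed.

Lemma ltn_lex m i i' j j' : j < m -> j' < m ->
  (i * m + j < i' * m + j') = (i < i') || (i == i') && (j < j').
Proof.
move=> hj hj'; case: (ltngtP i i') => [lt_i|lt_i|->] /=; last by rewrite ltn_add2l.
  have : i.+1 * m <= i' * m by rewrite leq_mul2r lt_i orbT.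
  lia.
have : i'.+1 * m <= i * m by rewrite leq_mul2r lt_i orbT.
lia.
Qed.

Lemma snake_lt flip m i : i < m -> snake flip m i < m.
Proof. by rewrite /snake; case: flip; lia. Qed.

Lemma snake_ltE flip m i i' : i < m -> i' < m ->
  (snake flip m i < snake flip m i') = if flip then i' < i else i < i'.
Proof. by rewrite /snake; case: flip; lia. Qed.

Lemma snake_eqE flip m i i' : i < m -> i' < m ->
  (snake flip m i == snake flip m i') = (i == i').
Proof. by rewrite /snake; case: flip; lia. Qed.

(** This and the next two comparisons follow from the lexicographic order and give the orientation
    of a step in each direction. *)
Lemma boustrophedon_lt1 u v : u.1.2 = v.1.2 -> u.2 = v.2 ->
  (boustrophedon u < boustrophedon v) =
  if odd (u.1.2 + u.2) then v.1.1 < u.1.1 else u.1.1 < v.1.1.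
Proof.
by move=> e2 e3; rewrite !boustrophedonE e2 e3 ltnS ltn_add2l snake_ltE.
Qed.

Lemma boustrophedon_lt2 u v : u.1.2 != v.1.2 -> u.2 = v.2 ->
  (boustrophedon u < boustrophedon v) =
  if odd u.2 then v.1.2 < u.1.2 else u.1.2 < v.1.2.
Proof.
move=> ne2 e3; rewrite !boustrophedonE ltnS ltn_lex ?snake_lt // e3.
by rewrite ltn_add2l eqn_add2l snake_eqE // snake_ltE // val_eqE (negPf ne2) orbF.
Qed.

Lemma boustrophedon_lt3 u v : u.2 != v.2 ->
  (boustrophedon u < boustrophedon v) = (u.2 < v.2).
Proof.
rewrite -val_eqE !boustrophedonE ltnS => /= ne3.
have lt_row (w w' : box (2 * n1) (2 * n2) m3) : w.2 != w'.2 :> nat ->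
    (w.2 * (2 * n2) + snake (odd w.2) (2 * n2) w.1.2 <
     w'.2 * (2 * n2) + snake (odd w'.2) (2 * n2) w'.1.2) = (w.2 < w'.2).
  by move=> ne; rewrite ltn_lex ?snake_lt // (negPf ne) orbF.
rewrite ltn_lex ?snake_lt // lt_row //.
case: eqP => [e|]; last by rewrite orbF.
have := lt_row u v ne3; have := lt_row v u; rewrite eq_sym => /(_ ne3).
by rewrite e ltnn; case: ltngtP ne3.
Qed.

(** It suffices that labels are injective. Equal labels force equal r, then equal q, then equal p,
    by the three comparisons in turn. *)
Lemma boustrophedon_anti u v : u != v ->
  (boustrophedon u < boustrophedon v) = ~~ (boustrophedon v < boustrophedon u).
Proof.
suff lab_inj : injective (fun w : box (2 * n1) (2 * n2) m3 => boustrophedon w).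
  by rewrite -(inj_eq lab_inj) /=; case: ltngtP.
move=> w w' /= e.
have l : (boustrophedon w < boustrophedon w') = false by rewrite e ltnn.
have l' : (boustrophedon w' < boustrophedon w) = false by rewrite e ltnn.
have e3 : w.2 = w'.2.
  apply/eqP/negPn/negP => ne; have ne' := ne; rewrite eq_sym in ne'.
  by move: l l' (ne); rewrite !boustrophedon_lt3 // -val_eqE /=; case: ltngtP.
have e2 : w.1.2 = w'.1.2.
  apply/eqP/negPn/negP => ne; have ne' := ne; rewrite eq_sym in ne'.
  move: l l' (ne); rewrite !boustrophedon_lt2 // e3 -val_eqE /=.
  by case: odd; case: ltngtP.
have e1 : w.1.1 = w'.1.1.
  apply: val_inj; move: l l'; rewrite !boustrophedon_lt1 // e2 e3 /=.
  by case: odd; case: ltngtP.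
by case: w w' e1 e2 e3 {e l l'} => [[? ?] ?] [[? ?] ?] /= -> -> ->.
Qed.

End Labels.

(** * Matrix entries contributed by the solid edges *)

Section Entries.

Variable R : comNzRingType.

Definition delta (i j : nat) : R := (i == j)%:R.
Definition hop (i j : nat) : R := (i.+1 == j)%:R - (j.+1 == i)%:R.

Lemma deltaii i : delta i i = 1.
Proof. by rewrite /delta eqxx. Qed.

Lemma delta_neq i j : i != j -> delta i j = 0.
Proof. by rewrite /delta => /negPf->. Qed.

Lemma hopE i j :
  hop i j = if differ_by1 i j then (if (i < j)%N then 1 else -1) else 0.
Proof.
rewrite /hop /differ_by1; case: eqP => [<-|_] /=.
  by rewrite ltnS leqnn (_ : (i.+2 == i) = false) ?subr0 //; lia.
by case: eqP => [<-|_]; rewrite ?subr0 // sub0r ltnNge leqnSn.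
Qed.

Lemma hopii i : hop i i = 0.
Proof. by rewrite /hop subrr. Qed.

Section Grid.

Variables (n1 n2 m3 : nat) (x a1 a2 a3 : R).
Local Notation box := (box (2 * n1) (2 * n2) m3).
Implicit Types u v : box.

(** A sum of Kronecker products: with S the diagonal matrix of signs [(-1) ^+ i] and H the matrix
    [hop], the three directions give H x S x S, 1 x H x S and 1 x 1 x H. *)
Definition solid u v : R :=
  x * (delta u.1.1 v.1.1 * delta u.1.2 v.1.2 * delta u.2 v.2)
  + a1 * (hop u.1.1 v.1.1 * (delta u.1.2 v.1.2 * (-1) ^+ u.1.2)
          * (delta u.2 v.2 * (-1) ^+ u.2))
  + a2 * (delta u.1.1 v.1.1 * hop u.1.2 v.1.2 * (delta u.2 v.2 * (-1) ^+ u.2))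
  + a3 * (delta u.1.1 v.1.1 * delta u.1.2 v.1.2 * hop u.2 v.2).

(** Extra edges are disjoint from solid edges and from the diagonal, so their contribution is simply
    added. This serves both the cylinder and the Möbius grid. *)
Lemma signed_adjacency_grid (extra o : rel box) :
  (forall u v, extra u v -> ~~ grid_edge u v && (u != v)) ->
  (forall u v, grid_edge u v -> o u v = (boustrophedon u < boustrophedon v)%N) ->
  forall u v,
  signed_adjacency (G := OWGraph (fun u v => grid_edge u v || extra u v) o
    (fun=> x) (grid_weight a1 a2 a3 extra)) u v
  = solid u v + (if extra u v then (if o u v then 1 else -1) * a1 else 0).
Proof.
move=> extraN olab u v; have gtn_lt m (i j : 'I_m) : i != j -> (j < i)%N = ~~ (i < j)%N.
  by rewrite -val_eqE /=; case: ltngtP.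
move: (extraN u v) (olab u v).
have lt1 := @boustrophedon_lt1 n1 n2 m3 u v.
have lt2 := @boustrophedon_lt2 n1 n2 m3 u v.
have lt3 := @boustrophedon_lt3 n1 n2 m3 u v.
rewrite /signed_adjacency /sgn /= /grid_weight /grid_edge /step1 /step2 /step3 /solid.
rewrite /crd1 /crd2 /crd3 !eqSS.
have dE i j : differ_by1 i.+1 j.+1 = differ_by1 i j by [].
rewrite !dE {dE}.
case: u v lt1 lt2 lt3 => [[p q] r] [[p' q'] r'] /= lt1 lt2 lt3.
rewrite !val_eqE !xpair_eqE.
(* Eight cases according to which coordinates agree; a solid entry off the diagonal survives only
   when exactly one differs. *)
case: (eqVneq p p') lt2 lt3 => [<-|np] lt2 lt3;
  case: (eqVneq q q') lt1 lt3 => [<-|nq] lt1 lt3;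
  case: (eqVneq r r') lt1 lt2 => [<-|nr] lt1 lt2; rewrite /= ?andbF ?andbT ?orbF /=.
all: rewrite ?deltaii ?hopii ?delta_neq ?val_eqE //.
all: rewrite ?(mul0r, mulr0, addr0, add0r, mul1r, mulr1).
- by case: (extra _ _) => [/(_ isT)|_ _] //; rewrite addr0.
- rewrite lt3 // hopE; case: (extra _ _) => [/(_ isT)|_]; case: (differ_by1 _ _) => //=.
  + by rewrite mulr0 add0r.
  + by move=> /(_ isT)->; rewrite addr0 mulrC.
  + by rewrite !mulr0 addr0.
- rewrite lt2 // hopE (gtn_lt _ _ _ nq).
  case: (extra _ _) => [/(_ isT)|_]; case: (differ_by1 _ _) => //=.
  + by rewrite mul0r mulr0 add0r.
  + move=> /(_ isT)->; rewrite addr0 -[X in _ * (_ * X)]signr_odd.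
    by case: odd; case: ltnP => _ /=; ring.
  + by rewrite mul0r !mulr0 addr0.
- by move=> _ _; case: (extra _ _).
- rewrite lt1 // hopE (gtn_lt _ _ _ np) oddD.
  case: (extra _ _) => [/(_ isT)|_]; case: (differ_by1 _ _) => //=.
  + by rewrite !mul0r mulr0 add0r.
  + move=> /(_ isT)->; rewrite addr0 -[X in _ * (_ * X)]signr_odd.
    rewrite -[X in _ * X * _]signr_odd.
    by case: odd; case: odd; case: ltnP => _ /=; ring.
  + by rewrite !mul0r !mulr0 addr0.
all: by move=> _ _; case: (extra _ _).
Qed.

End Grid.

End Entries.

(** * The bipartition of the grids *)

Definition coord_parity m1 m2 m3 (u : box m1 m2 m3) : bool :=
  odd (u.1.1 + u.1.2 + u.2).

Lemma grid_edge_parity m1 m2 m3 (u v : box m1 m2 m3) :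
  grid_edge u v -> coord_parity v = ~~ coord_parity u.
Proof.
case: u v => [[p q] r] [[p' q'] r'].
rewrite /coord_parity /grid_edge /step1 /step2 /step3 /differ_by1.
rewrite /crd1 /crd2 /crd3 /= !eqSS.
by case/or3P => /and3P[]; do ?[case/orP|move/eqP->|move/eqP<-|move=> _];
  rewrite !oddD //=; do 3!case: odd.
Qed.

(** * The signed adjacency matrix of the cylinder *)

Section Cylinder.

Variables (R : comNzRingType) (n1 n2 m3 : nat) (x a1 a2 a3 : R).
Hypothesis n1_gt1 : (1 < n1)%N.
Local Notation box := (box (2 * n1) (2 * n2) m3).
Implicit Types u v : box.

Lemma wrap_edge_parity u v :
  wrap_edge u v -> coord_parity v = ~~ coord_parity u.
Proof.
case: u v => [[p q] r] [[p' q'] r'].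
rewrite /coord_parity /wrap_edge /crd1 /crd2 /crd3 /= => /and3P[].
move=> pp' /eqP[->] /eqP[->]; rewrite !oddD.
have -> : odd p' = ~~ odd p.
  case/orP: pp' => /andP[/eqP[->] /eqP/(congr1 odd)]; rewrite oddM /=.
    by case: odd.
  by case: odd.
by do 3!case: odd.
Qed.

(** Labels direct a wrap-around edge from position 0 to the last position when q + r is even,
    opposite to the hop that would close the cycle coherently. This is what later gives the blocks
    [B] and [- B]. *)
Definition wrap_hop (p p' : nat) : R :=
  ((p == 0) && (p' == (2 * n1).-1))%N%:R - ((p' == 0) && (p == (2 * n1).-1))%N%:R.

Lemma cyl_adjacency u v :
  signed_adjacency (G := cyl_grid (2 * n1) (2 * n2) m3 x a1 a2 a3) u v =
  solid x a1 a2 a3 u v +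
  a1 * (wrap_hop u.1.1 v.1.1 * (delta R u.1.2 v.1.2 * (-1) ^+ u.1.2)
        * (delta R u.2 v.2 * (-1) ^+ u.2)).
Proof.
rewrite [LHS]signed_adjacency_grid; first 1 last.
- move=> {}u {}v; case: u v => [[p q] r] [[p' q'] r'].
  rewrite /wrap_edge /grid_edge /step1 /step2 /step3 /differ_by1.
  rewrite /crd1 /crd2 /crd3 /= !xpair_eqE !eqSS -(val_eqE p p') /=.
  move: (p : nat) (p' : nat) => {}p {}p' /and3P[pp' -> ->].
  (* [1 < n1] matters here: on a cycle of length 2 a wrap-around edge would coincide with a solid
     one. *)
  by rewrite andbT /=; case/orP: pp' => /andP[/eqP-> /eqP e]; rewrite -?e ?andbF /=; lia.
- by move=> {}u {}v uv; rewrite /label_arc /cyl_edge uv.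
congr (_ + _).
have last_eq (k : nat) : (k.+1 == 2 * n1)%N = (k == (2 * n1).-1).
  by apply/eqP/eqP; lia.
have M0 : ((2 * n1).-1 == 0%N) = false by lia.
rewrite /label_arc /cyl_edge orbC; case wuv: (wrap_edge u v) => /=; last first.
  have [e2|/delta_neq->] := eqVneq (u.1.2 : nat) v.1.2; last by rewrite !(mul0r, mulr0).
  have [e3|/delta_neq->] := eqVneq (u.2 : nat) v.2; last by rewrite !(mul0r, mulr0).
  move: wuv; rewrite /wrap_edge /crd1 /crd2 /crd3 e2 e3 !eqxx !andbT !eqSS !last_eq.
  by rewrite /wrap_hop => /norP[/negPf-> /negPf->]; rewrite subrr !(mul0r, mulr0).
have := wuv; rewrite /wrap_edge /crd1 /crd2 /crd3 !eqSS !last_eq.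
case/and3P=> pp' /eqP/val_inj e2 /eqP/val_inj e3.
rewrite boustrophedon_lt1 // e2 e3 !deltaii !mul1r oddD /wrap_hop.
rewrite -[in RHS](signr_odd _ v.1.2) -[in RHS](signr_odd _ v.2).
case/orP: pp' => /andP[/eqP-> /eqP->]; rewrite !eqxx lt0n ltn0 M0 /=;
  by case: odd; case: odd; rewrite /= ?expr0 ?expr1; ring.
Qed.

Lemma cyl_partition_function :
  Zcyl (2 * n1) (2 * n2) m3 x a1 a2 a3 =
  fdet (signed_adjacency (G := cyl_grid (2 * n1) (2 * n2) m3 x a1 a2 a3)).
Proof.
apply: (@partition_function_fdet _ (cyl_grid _ _ _ _ _ _ _) (@coord_parity _ _ _))
  => u v /=.
  by case/orP; [exact: grid_edge_parity | exact: wrap_edge_parity].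
have cyl_sym (w w' : box) : cyl_edge w w' = cyl_edge w' w.
  rewrite /cyl_edge /grid_edge /step1 /step2 /step3 /wrap_edge /differ_by1.
  have symC i j : (i.+1 == j) || (j.+1 == i) = (j.+1 == i) || (i.+1 == j) by rewrite orbC.
  rewrite (symC (crd1 w)) (symC (crd2 w)) (symC (crd3 w)) (eq_sym (crd1 w) (crd1 w')).
  rewrite (eq_sym (crd2 w) (crd2 w')) (eq_sym (crd3 w) (crd3 w')).
  by rewrite [(_ == 1%N) && _ || _]orbC.
move=> uv; rewrite /label_arc uv -cyl_sym uv /=.
apply: boustrophedon_anti; apply: contraTneq uv => <-.
rewrite /cyl_edge /grid_edge /step1 /step2 /step3 /wrap_edge /differ_by1.
rewrite /crd1 /crd2 /crd3; lia.
Qed.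

End Cylinder.

(** * The signed adjacency matrix of the Möbius grid *)

Section Mobius.

Variables n1 n2 n3 : nat.
Hypothesis n1_gt0 : (0 < n1)%N.
Local Notation box := (box (2 * n1) (2 * n2) (2 * n3)).
Implicit Types u v : box.

Definition opposite_ends (p p' : nat) : bool :=
  ((p == 0) && (p' == (2 * n1).-1) || (p' == 0) && (p == (2 * n1).-1))%N.

Lemma dashed_fromE u v :
  dashed_from u v =
  [&& (u.1.1 == 0%N :> nat) && (v.1.1 == (2 * n1).-1 :> nat),
      v.1.2 == rev_ord u.1.2 & v.2 == rev_ord u.2].
Proof.
have lt2 := ltn_ord u.1.2; have lt3 := ltn_ord u.2.
rewrite /dashed_from /crd1 /crd2 /crd3 -!val_eqE /= !eqSS -andbA.
congr [&& _, _, _ & _]; apply/eqP/eqP; lia.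
Qed.

Lemma dashed_edgeE u v :
  dashed_edge u v =
  [&& opposite_ends u.1.1 v.1.1, u.1.2 == rev_ord v.1.2 & u.2 == rev_ord v.2].
Proof.
have revC m (i j : 'I_m) : (j == rev_ord i) = (i == rev_ord j).
  by apply/eqP/eqP => ->; rewrite rev_ordK.
rewrite /dashed_edge !dashed_fromE /opposite_ends (revC _ u.1.2) (revC _ u.2).
by rewrite -andb_orl.
Qed.

Variable o : rel box.
Hypothesis ho : mobius_orientation o.

(** The square condition compares neighbouring dashed edges, so all of them are determined by the
    one at the vertex labelled 1. The formula holds from both ends, because reversing q over an even
    range changes its parity and so does reversing the edge. *)
Lemma dashed_arc u v : dashed_edge u v -> o u v = ~~ odd u.1.2.
Proof.
have [[o_edge o_anti] o_grid o_one o_square] := ho.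
have i0_lt : (0 < 2 * n1)%N by lia.
pose i0 := Ordinal i0_lt.
pose U q r : box := (i0, q, r).
pose V q r : box := (rev_ord i0, rev_ord q, rev_ord r).
have UV q r : dashed_edge (U q r) (V q r).
  by rewrite /dashed_edge dashed_fromE /= !eqxx /= subn1 eqxx.
have VU q r : dashed_edge (V q r) (U q r) by rewrite /dashed_edge orbC; exact: UV.
have anti q r : o (V q r) (U q r) = ~~ o (U q r) (V q r).
  by rewrite o_anti // /mob_edge VU orbT.
have i0_rev : (i0 == rev_ord i0) = false.
  by rewrite -val_eqE /=; lia.
have i0_rev' : (rev_ord i0 == i0) = false by rewrite eq_sym.
(* The two solid edges of this square lie in layers r and [rev_ord r] of opposite parity, so exactly
   one follows the traversal; hence neighbours in direction q have opposite orientations. *)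
have step_q (q q' : 'I_(2 * n2)) (r : 'I_(2 * n3)) : q'.+1 = q :> nat ->
    o (U q r) (V q r) = ~~ o (U q' r) (V q' r).
  move=> qq'; have nq : q' != q by rewrite -val_eqE /=; lia.
  have nq' : (rev_ord q' == rev_ord q) = false by rewrite (inj_eq rev_ord_inj) (negPf nq).
  have gVV : grid_edge (V q' r) (V q r).
    rewrite /grid_edge /step2 /differ_by1 /crd1 /crd2 /crd3 /= !eqxx.
    by have := ltn_ord q; rewrite -qq' => lt; lia.
  have gUU : grid_edge (U q r) (U q' r).
    rewrite /grid_edge /step2 /differ_by1 /crd1 /crd2 /crd3 /= !eqxx.
    by lia.
  have := o_square (U q' r) (V q' r) (V q r) (U q r).
  rewrite UV VU gVV gUU (o_grid _ _ gVV) (o_grid _ _ gUU)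
    !boustrophedon_lt2 //=;
    try by rewrite ?nq' // eq_sym.
  rewrite anti !inE !xpair_eqE i0_rev i0_rev' nq' (negPf nq) !andbF /=
    => /(_ isT isT isT isT isT).
  have -> : (q' < q)%N by rewrite -qq'.
  have -> : (q < q')%N = false by rewrite -qq' ltnNge leqnSn.
  have -> : (2 * n2 - q.+1 < 2 * n2 - q'.+1)%N by have := ltn_ord q; lia.
  have -> : (2 * n2 - q'.+1 < 2 * n2 - q.+1)%N = false by lia.
  rewrite oddB ?ltn_ord // oddM /=.
  by case: (odd r); case: (o _ _); case: (o _ _).
(* Here both solid edges run against the traversal, so neighbours in direction r have the same
   orientation. *)
have step_r (q : 'I_(2 * n2)) (r r' : 'I_(2 * n3)) : r'.+1 = r :> nat ->
    o (U q r) (V q r) = o (U q r') (V q r').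
  move=> rr'; have nr : r' != r by rewrite -val_eqE /=; lia.
  have nr' : (rev_ord r' == rev_ord r) = false by rewrite (inj_eq rev_ord_inj) (negPf nr).
  have gVV : grid_edge (V q r') (V q r).
    rewrite /grid_edge /step3 /differ_by1 /crd1 /crd2 /crd3 /= !eqxx.
    by have := ltn_ord r; rewrite -rr' => lt; lia.
  have gUU : grid_edge (U q r) (U q r').
    rewrite /grid_edge /step3 /differ_by1 /crd1 /crd2 /crd3 /= !eqxx.
    by lia.
  have := o_square (U q r') (V q r') (V q r) (U q r).
  rewrite UV VU gVV gUU (o_grid _ _ gVV) (o_grid _ _ gUU)
    !boustrophedon_lt3 //=;
    try by rewrite ?nr' // eq_sym.
  rewrite anti !inE !xpair_eqE i0_rev i0_rev' nr' (negPf nr) !andbF /=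
    => /(_ isT isT isT isT isT).
  have -> : (r < r')%N = false by rewrite -rr' ltnNge leqnSn.
  have -> : (2 * n3 - r'.+1 < 2 * n3 - r.+1)%N = false by lia.
  by case: (o _ _); case: (o _ _).
have arcU k l (hk : (k < 2 * n2)%N) (hl : (l < 2 * n3)%N) :
    o (U (Ordinal hk) (Ordinal hl)) (V (Ordinal hk) (Ordinal hl)) = ~~ odd k.
  (* Walk down in q, then in r, to the corner labelled 1, where the orientation is prescribed. *)
  elim: k hk => [|k IHk] hk; last first.
    by rewrite (step_q _ (Ordinal (ltnW hk))) //= IHk.
  elim: l hl => [|l IHl] hl; last first.
    by rewrite (step_r _ _ (Ordinal (ltnW hl))) //= IHl.
  by apply: o_one; rewrite ?UV // boustrophedonE.
have arc_from w w' : dashed_from w w' -> o w w' = ~~ odd w.1.2.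
  case: w w' => [[p [k hk]] [l hl]] [[p' q'] r']; rewrite dashed_fromE /=.
  case/and3P=> /andP[/eqP p0 /eqP p'0] /eqP-> /eqP->.
  have -> : p = i0 by apply: val_inj.
  have -> : p' = rev_ord i0 by apply: val_inj; rewrite /= p'0 subn1.
  exact: arcU.
move=> uv; have := uv; rewrite /dashed_edge; case/orP => [|vu]; first exact: arc_from.
rewrite o_anti ?arc_from ?negbK //; last by rewrite /mob_edge uv orbT.
have := vu; rewrite dashed_fromE => /and3P[_ /eqP-> _] /=.
by rewrite oddB ?ltn_ord // oddM /= negbK.
Qed.

Lemma dashed_edge_parity u v :
  dashed_edge u v -> coord_parity v = ~~ coord_parity u.
Proof.
rewrite dashed_edgeE /coord_parity => /and3P[pp' /eqP-> /eqP->] /=.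
rewrite !oddD !oddB ?ltn_ord // !oddM /=.
have -> : odd v.1.1 = ~~ odd u.1.1.
  have odd_last : odd (2 * n1).-1 by rewrite -subn1 oddB ?oddM //; lia.
  by case/orP: pp' => /andP[/eqP-> /eqP->]; rewrite odd_last.
by do 3!case: odd.
Qed.

Variables (R : comNzRingType) (x a1 a2 a3 : R).

Lemma mob_partition_function :
  Zmob o x a1 a2 a3 = fdet (signed_adjacency (G := mob_grid x a1 a2 a3 o)).
Proof.
have [[_ o_anti] _ _ _] := ho.
apply: (@partition_function_fdet _ (mob_grid _ _ _ _ _) (@coord_parity _ _ _))
  => u v /=.
  by case/orP; [exact: grid_edge_parity | exact: dashed_edge_parity].
exact: o_anti.
Qed.

(* The block B of the header; a dashed edge is this coupling composed with the
   reversal of the last two coordinates. *)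
Definition end_hop u v : R :=
  a1 * ((opposite_ends u.1.1 v.1.1)%:R * (delta R u.1.2 v.1.2 * (-1) ^+ u.1.2)
        * (delta R u.2 v.2 * (-1) ^+ u.2)).

Definition rev23 u : box := (u.1.1, rev_ord u.1.2, rev_ord u.2).

(** The second summand is the entry of [B] times [W]: the sign of [W] cancels the factor [(-1) ^+ r]
    of [end_hop] and leaves the sign [(-1) ^+ q] of a dashed edge. *)
Lemma mob_adjacency u v :
  signed_adjacency (G := mob_grid x a1 a2 a3 o) u v =
  solid x a1 a2 a3 u v + end_hop u (rev23 v) * (-1) ^+ (rev23 v).2.
Proof.
have [_ o_grid _ _] := ho.
rewrite [LHS]signed_adjacency_grid //; last first.
  move=> {}u {}v uv; have := dashed_edge_parity uv.
  case: eqP => [->|_]; first by case: coord_parity.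
  move=> _; rewrite andbT; apply/negP.
  (* Reversal of an even range has no fixed point, so a dashed edge changes both q and r, which no
     solid step does; this covers [n1 = 1] as well. *)
  have lt2 := ltn_ord v.1.2; have lt3 := ltn_ord v.2.
  move: uv; rewrite dashed_edgeE => /and3P[_ /eqP e2 /eqP e3].
  rewrite /grid_edge /step1 /step2 /step3 /differ_by1 /crd1 /crd2 /crd3 e2 e3 /=.
  lia.
congr (_ + _); rewrite /end_hop -[(rev23 v).1.1]/(v.1.1).
rewrite -[(rev23 v).1.2]/(rev_ord v.1.2) -[(rev23 v).2]/(rev_ord v.2).
case uv: (dashed_edge u v).
  rewrite dashed_arc //; have := uv; rewrite dashed_edgeE => /and3P[-> /eqP<- /eqP<-].
  rewrite !deltaii !mul1r -mulrA -mulrA -expr2 sqrr_sign mulr1 mulrC -[in RHS]signr_odd.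
  by case: odd.
move/negbT: uv; rewrite dashed_edgeE !negb_and.
by case/or3P=> [/negPf->|/delta_neq->|/delta_neq->]; rewrite !(mulr0, mul0r).
Qed.

End Mobius.

(** * Behaviour of the one-dimensional factors under reversal and under signs *)

Section Reflections.

Variables (R : comNzRingType) (m : nat).
Implicit Types i j : 'I_m.

Lemma delta_rev i j : delta R (rev_ord i) (rev_ord j) = delta R i j.
Proof. by rewrite /delta !val_eqE (inj_eq rev_ord_inj). Qed.

Lemma hop_rev i j : hop R (rev_ord i) (rev_ord j) = - hop R i j.
Proof.
have lti := ltn_ord i; have ltj := ltn_ord j.
rewrite /hop opprB; congr (_%:R - _%:R); congr (nat_of_bool _); rewrite /=; lia.
Qed.

Lemma sign_rev i : ~~ odd m -> (-1) ^+ (rev_ord i) = - (-1) ^+ i :> R.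
Proof.
move=> m_even; rewrite -signr_odd oddB ?ltn_ord // (negPf m_even) /= signrN signr_odd.
by [].
Qed.

Lemma delta_sign (i j : nat) : delta R i j * (-1) ^+ j = delta R i j * (-1) ^+ i.
Proof. by rewrite /delta; case: eqP => [->|]; rewrite ?mul0r. Qed.

Lemma hop_sign (i j : nat) : hop R i j * (-1) ^+ j = - (hop R i j * (-1) ^+ i).
Proof.
rewrite hopE /differ_by1; case: ifP; last by rewrite !mul0r oppr0.
by case/orP=> /eqP<-; rewrite exprS; ring.
Qed.

End Reflections.

(** * The cylinder as a double cover of the Möbius grid *)

Section Cover.

Variables (R : comNzRingType) (n1 n2 n3 : nat) (x a1 a2 a3 : R).
Hypothesis n1_gt0 : (0 < n1)%N.
Local Notation box := (box (2 * n1) (2 * n2) (2 * n3)).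
Implicit Types u v : box.

Definition rev1 u : box := (rev_ord u.1.1, u.1.2, u.2).

Lemma end_hop_sign (p p' : nat) :
  (opposite_ends n1 p p')%:R * (-1) ^+ p' =
  - ((opposite_ends n1 p p')%:R * (-1) ^+ p) :> R.
Proof.
have odd_last : odd (2 * n1).-1 by rewrite -subn1 oddB ?oddM //; lia.
rewrite /opposite_ends; case: orP; last by rewrite !mul0r oppr0.
by case=> /andP[/eqP-> /eqP->]; rewrite -[in LHS]signr_odd
  -[in RHS]signr_odd odd_last /=; ring.
Qed.

Lemma opposite_ends_rev (p p' : 'I_(2 * n1)) :
  opposite_ends n1 (rev_ord p) (rev_ord p') = opposite_ends n1 p p'.
Proof.
have ltp := ltn_ord p; have ltp' := ltn_ord p'.
rewrite /opposite_ends /=; lia.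
Qed.

(** This is [W] commuting with [A]. In every term an even number of factors change sign: in the
    third direction the reversed hop and its anticommutation with [(-1) ^+ r], in the other two a
    pair of reversed factors. *)
Lemma solid_rev23 u v :
  (-1) ^+ u.2 * solid x a1 a2 a3 (rev23 u) (rev23 v) =
  solid x a1 a2 a3 u v * (-1) ^+ v.2.
Proof.
have even2 k : ~~ odd (2 * k) by rewrite oddM.
have e1 w : (rev23 w).1.1 = w.1.1 by [].
have e2 w : (rev23 w).1.2 = rev_ord w.1.2 by [].
have e3 w : (rev23 w).2 = rev_ord w.2 by [].
rewrite /solid !e1 !e2 !e3 !delta_rev !hop_rev !sign_rev //.
have := delta_sign R u.2 v.2; have := hop_sign R u.2 v.2.
move: (delta _ u.2 _) (hop _ u.2 _) ((-1) ^+ u.2) ((-1) ^+ v.2)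
  ((-1) ^+ u.1.2) => d h s s' t H1 H2.
ring: H1 H2.
Qed.

Lemma solid_rev1 u v :
  (-1) ^+ u.1.1 * solid x a1 a2 a3 (rev1 u) (rev1 v) =
  solid x a1 a2 a3 u v * (-1) ^+ v.1.1.
Proof.
have e1 w : (rev1 w).1.1 = rev_ord w.1.1 by [].
have e2 w : (rev1 w).1.2 = w.1.2 by [].
have e3 w : (rev1 w).2 = w.2 by [].
rewrite /solid !e1 !e2 !e3 !delta_rev !hop_rev.
have := delta_sign R u.1.1 v.1.1; have := hop_sign R u.1.1 v.1.1.
move: (delta _ u.1.1 _) (hop _ u.1.1 _) ((-1) ^+ u.1.1) ((-1) ^+ v.1.1) => d h s s' H1 H2.
move: (delta _ u.1.2 _) (hop _ u.1.2 _) (delta _ u.2 _) (hop _ u.2 _) => d2 h2 d3 h3.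
move: ((-1) ^+ u.1.2) ((-1) ^+ u.2) => s2 s3.
(* Terms are grouped by their factor in the first coordinate, so that each parity relation can be
   applied as a rewriting rule. *)
transitivity ((x * d2 * d3 + a2 * h2 * d3 * s3 + a3 * d2 * h3) * (d * s')
  + a1 * d2 * s2 * d3 * s3 * (h * s')); last by ring.
by rewrite H1 H2; ring.
Qed.

Lemma end_hop_rev23 u v :
  (-1) ^+ u.2 * end_hop a1 (rev23 u) (rev23 v) = end_hop a1 u v * (-1) ^+ v.2.
Proof.
have even2 k : ~~ odd (2 * k) by rewrite oddM.
have e1 w : (rev23 w).1.1 = w.1.1 by [].
have e2 w : (rev23 w).1.2 = rev_ord w.1.2 by [].
have e3 w : (rev23 w).2 = rev_ord w.2 by [].
rewrite /end_hop !e1 !e2 !e3 !delta_rev !sign_rev //.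
have := delta_sign R u.2 v.2.
move: (delta _ u.2 _) ((-1) ^+ u.2) ((-1) ^+ v.2) ((-1) ^+ u.1.2) => d s s' t H1.
ring: H1.
Qed.

(** Exchanging the ends preserves [opposite_ends], but the two ends have opposite parity, whence the
    single minus sign. *)
Lemma end_hop_rev1 u v :
  (-1) ^+ u.1.1 * end_hop a1 (rev1 u) (rev1 v) = - (end_hop a1 u v * (-1) ^+ v.1.1).
Proof.
have e1 w : (rev1 w).1.1 = rev_ord w.1.1 by [].
have e2 w : (rev1 w).1.2 = w.1.2 by [].
have e3 w : (rev1 w).2 = w.2 by [].
rewrite /end_hop !e1 !e2 !e3 opposite_ends_rev.
have := end_hop_sign u.1.1 v.1.1.
move: (_%:R) ((-1) ^+ u.1.1) ((-1) ^+ v.1.1) => b s s' H1.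
move: ((-1) ^+ u.1.2) ((-1) ^+ u.2) => s2 s3.
ring: H1.
Qed.

Lemma sign_mul_rev m (i : 'I_m) : ~~ odd m -> (-1) ^+ i * (-1) ^+ (rev_ord i) = -1 :> R.
Proof. by move=> m_even; rewrite sign_rev // mulrN -expr2 sqrr_sign. Qed.

Lemma double_length : (2 * n1 + 2 * n1 = 2 * (2 * n1))%N.
Proof. lia. Qed.

Definition glue (w : box + box) : Defs.box (2 * (2 * n1)) (2 * n2) (2 * n3) :=
  match w with
  | inl u => (cast_ord double_length (lshift _ u.1.1), u.1.2, u.2)
  | inr u => (cast_ord double_length (rshift _ u.1.1), u.1.2, u.2)
  end.

Lemma glue_bij : bijective glue.
Proof.
apply: inj_card_bij; last by rewrite card_sum !card_prod !card_ord; lia.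
move=> [[[p q] r]|[[p q] r]] [[[p' q'] r']|[[p' q'] r']] /= [].
- by move=> /val_inj -> -> ->.
- by have := ltn_ord p; move=> lt e; lia.
- by have := ltn_ord p'; move=> lt e; lia.
- by move=> /addnI/val_inj -> -> ->.
Qed.

Lemma wrap_hop0 (p p' : nat) : (p < 2 * n1)%N -> (p' < 2 * n1)%N ->
  wrap_hop R (2 * n1) p p' = 0.
Proof.
move=> ltp ltp'; have lt2 k : (k < 2 * n1)%N -> (k == (2 * (2 * n1)).-1) = false.
  by move=> ?; apply/eqP; lia.
by rewrite /wrap_hop !lt2 // !andbF subrr.
Qed.

Lemma wrap_hop_shift (p p' : nat) :
  wrap_hop R (2 * n1) (2 * n1 + p) (2 * n1 + p') = 0.
Proof.
have neq0 k : (2 * n1 + k == 0)%N = false by apply/eqP; lia.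
by rewrite /wrap_hop !neq0 subrr.
Qed.

(** The halves meet at two seams, the solid edge in the middle and the wrap-around edge. Both are
    positive from the first half to the second, and they never apply to the same pair because
    [2 * n1 - 1] is not 0. *)
Lemma glue_hop (p p' : nat) : (p < 2 * n1)%N -> (p' < 2 * n1)%N ->
  hop R p (2 * n1 + p') + wrap_hop R (2 * n1) p (2 * n1 + p') =
  (opposite_ends n1 p p')%:R.
Proof.
move=> ltp ltp'; rewrite /hop /wrap_hop /opposite_ends.
have -> : ((2 * n1 + p').+1 == p) = false by apply/eqP; lia.
have -> : (2 * n1 + p' == 0)%N = false by apply/eqP; lia.
rewrite !subr0 -natrD; congr (_%:R).
by do ![case: eqP => ? /=]; lia.
Qed.

Lemma glue_hop' (p p' : nat) : (p < 2 * n1)%N -> (p' < 2 * n1)%N ->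
  hop R (2 * n1 + p) p' + wrap_hop R (2 * n1) (2 * n1 + p) p' =
  - (opposite_ends n1 p p')%:R.
Proof.
move=> ltp ltp'; have -> : opposite_ends n1 p p' = opposite_ends n1 p' p.
  by rewrite /opposite_ends orbC.
by rewrite -glue_hop // opprD /hop /wrap_hop !opprB.
Qed.

Lemma cylinder_det :
  fdet (signed_adjacency
    (G := cyl_grid (2 * (2 * n1)) (2 * n2) (2 * n3) x a1 a2 a3)) =
  fdet (fun u v => solid x a1 a2 a3 u v +
    end_hop a1 u (rev23 v) * (-1) ^+ (rev23 v).2) ^+ 2.
Proof.
have even2 k : ~~ odd (2 * k) by rewrite oddM.
have len : (1 < 2 * n1)%N by lia.
apply: (fdet_double_cover (B := end_hop a1) (f := @rev23 n1 n2 n3) (g := rev1)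
  (c := fun u => (-1) ^+ u.2) (e := fun u => (-1) ^+ u.1.1) glue_bij).
- move=> u v; rewrite cyl_adjacency // /solid /= wrap_hop0 ?ltn_ord //.
  by rewrite !(mul0r, mulr0) addr0.
(* Positions in different halves never agree, so only the first direction couples the halves. *)
- move=> u v; rewrite cyl_adjacency // /solid /= delta_neq; last first.
    by rewrite neq_ltn ltn_addr.
  have [ltp ltp'] := (ltn_ord u.1.1, ltn_ord v.1.1).
  rewrite !(mul0r, mulr0) add0r !addr0 -mulrDr -!mulrDl; congr (_ * (_ * _ * _)).
  exact: glue_hop.
- move=> u v; rewrite cyl_adjacency // /solid /= delta_neq; last first.
    by rewrite neq_ltn orbC ltn_addr.
  have [ltp ltp'] := (ltn_ord u.1.1, ltn_ord v.1.1).
  rewrite !(mul0r, mulr0) add0r !addr0 -mulrDr -!mulrDl -mulrN -!mulNr.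
  by congr (_ * (_ * _ * _)); rewrite glue_hop'.
- move=> u v; rewrite cyl_adjacency // /solid /= wrap_hop_shift //.
  rewrite !(mul0r, mulr0) addr0 /delta /hop eqn_add2l.
  by rewrite -!addnS !eqn_add2l.
- by move=> u; rewrite /rev23 /= !rev_ordK; case: u => [[]].
- by move=> u; exact: sign_mul_rev.
- by move=> u; rewrite /rev1 /= !rev_ordK; case: u => [[]].
- by move=> u; exact: sign_mul_rev.
- exact: solid_rev23.
- exact: end_hop_rev23.
- exact: solid_rev1.
(* [rev1] commutes with [rev23] and leaves the sign of [W] unchanged, so the anticommutation passes
   from [B] to [B] times [W]. *)
- move=> u v; have := end_hop_rev1 u (rev23 v).
  rewrite -[rev1 (rev23 v)]/(rev23 (rev1 v)) mulrA => ->.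
  by rewrite mulNr mulrAC.
Qed.

End Cover.

Theorem theorem4p8 (R : comNzRingType) (x a1 a2 a3 : R) (n1 n2 n3 : nat)
    (hn1 : (0 < n1)%N) (hn2 : (0 < n2)%N) (hn3 : (0 < n3)%N)
    (o : rel (box (2 * n1) (2 * n2) (2 * n3)))
    (ho : mobius_orientation o) :
  Zcyl (4 * n1) (2 * n2) (2 * n3) x a1 a2 a3
  = Zmob o x a1 a2 a3 ^+ 2.
Proof.
have -> : (4 * n1 = 2 * (2 * n1))%N by rewrite mulnA.
(* The cylinder results are applied with half-length [2 * n1], which exceeds 1 as they require. *)
rewrite cyl_partition_function ?cylinder_det //; last by lia.
rewrite mob_partition_function //; congr (_ ^+ 2).
apply: eq_bigr => s _; congr (_ * _); apply: eq_bigr => u _.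
by rewrite mob_adjacency.
Qed.
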